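(* Let $\mathcal{G}=(G,L)$ be a primitive labeled graph, and let $X_{\mathcal{G}}$ be the sofic shift it presents. Then the covering radius $R(X_{\mathcal{G}})$ is a rational number.
   Context: A graph $G=(\mathcal{V}_G,\mathcal{E}_G)$ means a finite directed graph with vertex set $\mathcal{V}_G$ and edge set $\mathcal{E}_G$; each edge $e$ has a source $s(e)$ and a target $t(e)$ in $\mathcal{V}_G$; parallel edges and self-loops are allowed. A walk of length $n\ge 1$ is a tuple $(e_1,\dots,e_n)\in\mathcal{E}_G^n$ with $t(e_k)=s(e_{k+1})$ for $1\le k<n$. $G$ is irreducible if any two vertices are connected by a walk. A cycle is a walk with $s(e_1)=t(e_n)$ (no injectivity required). An irreducible graph is primitive if the greatest common divisor of all its cycle lengths is $1$. A labeled graph is a pair $\mathcal{G}=(G,L)$ with $G$ a graph and $L:\mathcal{E}_G\to\Sigma$ a function to a finite alphabet $\Sigma$; it is primitive if $G$ is. Let $\mathcal{C}_n(\mathcal{G})\subseteq\Sigma^n$ be the set of words $(L(e_1),\dots,L(e_n))$ over all walks $(e_1,\dots,e_n)$ of length $n$ in $G$. Define $X_{\mathcal{G}}=\{x\in\Sigma^{\mathbb{Z}} : (x_m,\dots,x_n)\in\mathcal{C}_{n-m+1}(\mathcal{G})\ \text{for all } m\le n\}$. The Hamming distance $d_H(u,v)$ of $u,v\in\Sigma^n$ is the number of coordinates $i$ with $u_i\ne v_i$. The covering radius of a code $\mathcal{C}\subseteq\Sigma^n$ is $R(\mathcal{C})=\max_{v\in\Sigma^n}\min_{w\in\mathcal{C}}d_H(v,w)$.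 For a shift space $X\subseteq\Sigma^{\mathbb{Z}}$ (closed shift-invariant subset) let $\mathcal{C}_n(X)=\{(x_1,\dots,x_n):x\in X\}$. The covering radius of $X$ is $R(X)=\lim_{n\to\infty}\frac1n R(\mathcal{C}_n(X))$ when the limit exists; it is known that the limit exists for $X=X_{\mathcal{G}}$ for any labeled graph $\mathcal{G}$. *)

(* Defs.v *)
From HB Require Import structures.
From mathcomp Require Import all_boot all_order all_algebra.
From mathcomp Require Import boolp classical_sets reals topology normedtype sequences.
Set Implicit Arguments.
Unset Strict Implicit.
Unset Printing Implicit Defensive.
Import Order.TTheory GRing.Theory Num.Theory.
Import numFieldNormedType.Exports.
Local Open Scope ring_scope.

Record graph := Graph {
  vertex : finType;
  edge : finType;
  src : edge -> vertex;
  tgt : edge -> vertex }.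

Definition walk (G : graph) (w : seq (edge G)) : bool :=
  (w != [::]) && sorted (fun e f => tgt e == src f) w.

Definition walk_between (G : graph) (u v : vertex G) (w : seq (edge G)) : bool :=
  walk w && (if w is e :: w' then (src e == u) && (tgt (last e w') == v)
             else false).

Definition irreducible_graph (G : graph) : Prop :=
  forall u v : vertex G, exists w : seq (edge G), walk_between u v w.

Definition cycle_walk (G : graph) (w : seq (edge G)) : Prop :=
  exists v : vertex G, walk_between v v w.

Definition cycle_length (G : graph) (n : nat) : Prop :=
  exists w : seq (edge G), cycle_walk w /\ size w = n.

(* Greatest for divisibility, so that the gcd of the empty set is 0; the set  *)
(* may be infinite.                                                           *)
Definition is_gcd (S : nat -> Prop) (g : nat) : Prop :=
  (forall n, S n -> (g %| n)%N) /\
  (forall d, (forall n, S n -> (d %| n)%N) -> (d %| g)%N).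

Definition primitive_graph (G : graph) : Prop :=
  irreducible_graph G /\ is_gcd (@cycle_length G) 1.

Record labeled_graph (A : finType) := LabeledGraph {
  lgraph : graph;
  label : edge lgraph -> A }.

Definition primitive_labeled_graph (A : finType) (G : labeled_graph A) : Prop :=
  primitive_graph (lgraph G).

Definition graph_code (A : finType) (G : labeled_graph A) (n : nat) :
    {set n.-tuple A} :=
  [set map_tuple (@label A G) w | w : n.-tuple (edge (lgraph G)) & walk w]%SET.

(* [window x m k] is the word (x_m, ..., x_(m+k-1)).                          *)
Definition window (A : Type) (x : int -> A) (m : int) (k : nat) : k.-tuple A :=
  [tuple x (m + (i : nat)%:Z) | i < k].

Definition sofic_shift (A : finType) (G : labeled_graph A) : set (int -> A) :=
  fun x => forall m n : int, m <= n ->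
    window x m `|(n - m + 1)%R|%N \in graph_code G `|(n - m + 1)%R|%N.

Definition hamming (A : finType) (n : nat) (u v : n.-tuple A) : nat :=
  #|[set i : 'I_n | tnth u i != tnth v i]%SET|.

(* The minimum is based at n, which bounds every Hamming distance, so it is   *)
(* the true minimum as soon as C is nonempty.                                 *)
Definition code_covering_radius (A : finType) (n : nat) (C : {set n.-tuple A}) :
    nat :=
  (\max_(v : n.-tuple A) \big[minn/n]_(w in C) hamming v w)%N.

Definition shift_code (A : finType) (X : set (int -> A)) (n : nat) :
    {set n.-tuple A} :=
  [set w : n.-tuple A | `[< exists x, X x /\ window x 1 n = w >]]%SET.

Definition covering_rate (R : realType) (A : finType) (X : set (int -> A))
    (n : nat) : R :=
  (code_covering_radius (shift_code X n))%:R / n%:R.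

(* Meaningful only when [covering_rate R X] converges.                        *)
Definition covering_radius (R : realType) (A : finType) (X : set (int -> A)) :
    R :=
  limn (covering_rate R X).

(* Main.v *)
(* Let Y_w(v) be the least number of mismatches between w and the labels of   *)
(* a walk starting at v, so that f(w) = min_v Y_w(v) is the distance from w   *)
(* to the code. Prepending letters to w acts on Y_w by min-plus linear maps,  *)
(* which commute with adding constants. As any two vertices are joined by a   *)
(* walk of one fixed length N, the oscillation of Y_w is at most N; hence     *)
(* Y_w - f(w) takes finitely many values, and f is the weight of a walk in a  *)
(* finite weighted digraph whose states are these values. The largest f(w)    *)
(* over the words of length n is therefore n times the largest mean weight of *)
(* a short cycle, up to a bounded error.                                      *)

Require Import Defs.
From mathcomp Require Import all_boot all_order all_algebra.
From mathcomp Require Import boolp classical_sets reals topology normedtype sequences.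
From mathcomp Require Import zify ring.
Import numFieldNormedType.Exports.

Set Implicit Arguments.
Unset Strict Implicit.
Unset Printing Implicit Defensive.

(** Prepended letters move through finitely many normalised cost functions ([profile]), and the
    amount by which a given prefix raises the distance depends only on the current one
    ([distance_class]). The worst growth is thus a maximum mean cycle problem. Cutting out repeated
    states bounds the distance of every word by p/q times its length, where p/q is the best ratio of
    a short cycle ([growth_upper]); repeating a best cycle reaches this rate ([growth_lower]). Both
    hold up to a constant.

    Primitivity enters through [primitive_index], whose walks of common length [N] make the set of
    profiles finite ([value_osc]). By [sofic_code] and [bigmin_hamming], the covering radius of the
    length n code is the largest distance of a word of length n, so the rate tends to p/q. *)

(** * Growth along a finite weighted digraph of states *)

Section PrependGrowth.
Variables (A T : finType) (a0 : A) (f : seq A -> nat) (pi : seq A -> T).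
Hypothesis f_nil : f [::] = 0.
Hypothesis f_mono : forall w u, f u <= f (w ++ u).
Hypothesis f_lip : forall w u, f (w ++ u) <= size w + f u.
(* [pi] records the state of the finite digraph; [f (w ++ u) - f u], the weight
   of the walk reading [w] from that state, depends on [u] only through [pi u]. *)
Hypothesis f_class :
  forall u u' w, pi u = pi u' -> f (w ++ u) + f u' = f (w ++ u') + f u.

(** A closed walk of length [q] and weight [p] in the digraph of states, based at the state of
    [w1]. *)
Definition class_cycle (q p : nat) : Prop :=
  exists w1 w2, [/\ size w2 = q, pi (w2 ++ w1) = pi w1 & f (w2 ++ w1) = p + f w1].

Lemma suffix_repeat w : #|T| <= size w -> exists w3 w2 w1,
  [/\ w = w3 ++ w2 ++ w1, 0 < size w2 <= #|T| & pi (w2 ++ w1) = pi w1].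
Proof.
move=> lew.
have /injectivePn[i [j neq_ij eq_pi]] :
    ~~ injectiveb (fun i : 'I_(#|T|.+1) => pi (drop i w)).
  by apply/injectiveP => /leq_card; rewrite card_ord ltnn.
have repeat (i' j' : 'I_(#|T|.+1)) : i' < j' ->
    pi (drop i' w) = pi (drop j' w) -> exists w3 w2 w1,
  [/\ w = w3 ++ w2 ++ w1, 0 < size w2 <= #|T| & pi (w2 ++ w1) = pi w1].
  move=> lt_ij eq_ij; exists (take i' w), (take (j' - i') (drop i' w)), (drop j' w).
  have E : take (j' - i') (drop i' w) ++ drop j' w = drop i' w.
    by rewrite -[RHS](cat_take_drop (j' - i')) drop_drop subnK // ltnW.
  have := ltn_ord j'; rewrite E cat_take_drop size_take size_drop; split => //.
  by case: ifP; lia.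
have [lt_ij|lt_ji|/val_inj eq_ij] := ltngtP i j.
- exact: repeat lt_ij eq_pi.
- exact: repeat lt_ji (esym eq_pi).
- by rewrite eq_ij eqxx in neq_ij.
Qed.

Lemma cycle_gain_le q p : class_cycle q p -> p <= q.
Proof. by case=> w1 [w2 [<- _ E]]; have := f_lip w2 w1; lia. Qed.

(** Weights are bounded by lengths, so the short cycles give finitely many pairs; at least one
    exists by pigeonhole, and rational ratios can be compared. *)
Lemma max_cycle_ratio : exists q p, [/\ 0 < q, class_cycle q p &
  forall q' p', 0 < q' <= #|T| -> class_cycle q' p' -> p' * q <= p * q'].
Proof.
pose K := #|T|.+1.
pose P (x : 'I_K * 'I_K) := (0 < x.1) && `[< class_cycle x.1 x.2 >].
have toP q p : 0 < q <= #|T| -> class_cycle q p ->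
    exists x : 'I_K * 'I_K, [/\ P x, q = x.1 & p = x.2].
  move=> /andP[q0 qT] cqp; have pq := cycle_gain_le cqp.
  exists (inord q, inord p); rewrite /P /= !inordK ?ltnS ?q0 //; last exact: leq_trans qT.
  by split=> //; apply/asboolP.
have [x0 Px0] : exists x, P x.
  have [|w3 [w2 [w1 [_ sw2 e]]]] := @suffix_repeat (nseq #|T| a0).
    by rewrite size_nseq.
  have /(toP _ _ sw2)[x [Px _ _]] : class_cycle (size w2) (f (w2 ++ w1) - f w1).
    by exists w1, w2; split=> //; rewrite subnK.
  by exists x.
pose ratio (x : 'I_K * 'I_K) : rat := (x.2%:R / x.1%:R)%R.
have [x Px xmax] := @Order.TotalTheory.arg_maxP _ _ _ x0 P ratio Px0.
have /andP[x10 /asboolP cx] := Px.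
exists x.1, x.2; split=> // q' p' /[dup] /andP[q'0 _] /toP h /h[y [Py -> ->]].
have /andP[y10 _] := Py.
have : (ratio y <= ratio x)%R := xmax _ Py.
rewrite /ratio Num.Theory.ler_pdivrMr ?Num.Theory.ltr0n // GRing.mulrAC.
by rewrite Num.Theory.ler_pdivlMr ?Num.Theory.ltr0n // -!GRing.natrM Num.Theory.ler_nat.
Qed.

(** Strong induction on the length: by [f_class], cutting out the factor between two equal states
    lowers [f] by exactly the weight of a short cycle. Words too short to repeat a state cost less
    than [#|T|]. *)
Lemma growth_upper (q p : nat) :
  (forall q' p', 0 < q' <= #|T| -> class_cycle q' p' -> p' * q <= p * q') ->
  forall w, q * f w <= p * size w + q * #|T|.
Proof.
move=> pq_max w; have [n] := ubnP (size w); elim: n w => // n IH w lt_wn.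
have [lt_wT|le_Tw] := ltnP (size w) #|T|.
  have := f_lip w [::]; rewrite cats0 f_nil addn0 => le_fw.
  by apply: leq_trans (leq_addl _ _); rewrite leq_mul2l; lia.
have [w3 [w2 [w1 [Ew sw2 e]]]] := suffix_repeat le_Tw.
have cyc : class_cycle (size w2) (f (w2 ++ w1) - f w1).
  by exists w1, w2; split=> //; rewrite subnK.
have := pq_max _ _ sw2 cyc; have := f_class w3 e; have := f_mono w2 w1.
have := IH (w3 ++ w1); rewrite Ew !size_cat in lt_wn *.
move: (f _) (f _) (f _) (f _) => x y z t.
move=> /(_ ltac:(lia)); nia.
Qed.

Lemma iter_cycle p w1 w2 : pi (w2 ++ w1) = pi w1 -> f (w2 ++ w1) = p + f w1 ->
  forall k, f (flatten (nseq k w2) ++ w1) = k * p + f w1.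
Proof.
(* The new copy of [w2] is taken next to [w1], where the equality of states [e] lets [f_class]
   apply. *)
move=> e E; elim=> [//|k IH]; rewrite -addn1 nseqD flatten_cat /= cats0 -catA.
by have := f_class (flatten (nseq k w2)) e; lia.
Qed.

Lemma growth_lower q p : 0 < q -> class_cycle q p ->
  exists C, forall n, exists2 w, size w = n & p * n <= q * f w + C.
Proof.
move=> q0 [w1 [w2 [sw2 e E]]]; exists (p * (q + size w1)) => n.
have [le_n|lt_n] := leqP n (q + size w1).
  exists (nseq n a0); first by rewrite size_nseq.
  by apply: leq_trans (leq_addl _ _); rewrite leq_mul2l le_n orbT.
pose k := (n - size w1) %/ q; pose r := (n - size w1) %% q.
have En : n - size w1 = k * q + r by exact: divn_eq.
have lt_r : r < q by rewrite ltn_mod.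
have size_k : size (flatten (nseq k w2)) = k * q.
  by rewrite size_flatten /shape map_nseq sumn_nseq sw2 mulnC.
(* Only the padding of length [r < q] and the base [w1] can lose weight, at most [p * (q + size w1)]
   in all. *)
exists (nseq r a0 ++ flatten (nseq k w2) ++ w1).
  by rewrite !size_cat size_nseq size_k; lia.
have := f_mono (nseq r a0) (flatten (nseq k w2) ++ w1).
rewrite (iter_cycle e E) => le_f.
have -> : n = k * q + r + size w1 by lia.
move: (f _) le_f => x le_f; nia.
Qed.

Lemma linear_growth : exists q p C, 0 < q /\ forall n,
  (forall w, size w = n -> q * f w <= p * n + C) /\
  (exists2 w, size w = n & p * n <= q * f w + C).
Proof.
have [q [p [q0 cyc pq_max]]] := max_cycle_ratio.
have [C lowerC] := growth_lower q0 cyc.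
exists q, p, (q * #|T| + C); split=> // n; split.
  by move=> w <-; apply: leq_trans (growth_upper pq_max w) _; lia.
by have [w sw le_w] := lowerC n; exists w => //; lia.
Qed.

End PrependGrowth.

(** * Primitivity and walks of a common length *)

(* The least positive difference d of two elements divides every element s, as
   otherwise s %% d would be a smaller difference; so d = 1 and S contains two
   consecutive numbers x and x + 1. *)
Lemma cofinite_of_additive (S : nat -> Prop) :
  S 0 -> (forall m n, S m -> S n -> S (m + n)) ->
  (forall d, (forall n, S n -> d %| n) -> d %| 1) ->
  exists K, forall n, K <= n -> S n.
Proof.
move=> S0 SD Sgcd.
have SM k m : S m -> S (k * m).
  by move=> Sm; elim: k => [|k IH] //; rewrite mulSn; exact: SD.
pose P d := `[< 0 < d /\ exists2 x, S x & S (x + d) >].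
have exP : exists d, P d.
  have [[s [s0 Ss]]|no_s] := pselect (exists s, 0 < s /\ S s).
    by exists s; apply/asboolP; split=> //; exists 0.
  have /Sgcd // : forall n, S n -> 2 %| n.
  by case=> // n Sn; case: no_s; exists n.+1.
case: (ex_minnP exP) => d /asboolP[d0 [x Sx Sxd]] d_min.
have d1 : d = 1.
  apply/eqP; rewrite -dvdn1; apply: Sgcd => s Ss; rewrite /dvdn -leqn0 leqNgt.
  apply/negP => r0; have /d_min : P (s %% d).
    apply/asboolP; split=> //; exists (s %/ d * (x + d)); first exact: SM.
    have -> : s %/ d * (x + d) + s %% d = s + s %/ d * x.
      by rewrite {3}(divn_eq s d); lia.
    by apply: SD => //; exact: SM.
  by rewrite leqNgt ltn_mod d0.
(* With [r = n %% x], take [r] copies of [x + 1] and [n %/ x - r] copies of [x]; the latter count is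
   nonnegative once [n >= x * x]. *)
exists (x * x) => n le_n; have [x0|x_gt0] := posnP x.
  by rewrite -(muln1 n); apply: SM; rewrite x0 d1 in Sxd.
have lt_r : n %% x < x by rewrite ltn_mod.
have le_k : x <= n %/ x by rewrite leq_divRL.
have -> : n = (n %/ x - n %% x) * x + n %% x * (x + 1).
  by rewrite {1}(divn_eq n x); nia.
by rewrite d1 in Sxd; apply: SD; exact: SM.
Qed.

Section Paths.
Variable G : graph.
Implicit Types (u v t : vertex G) (w : seq (edge G)).

Fixpoint epath u v w : bool :=
  if w is e :: w' then (src e == u) && epath (tgt e) v w' else u == v.

Lemma epath_cat u t v w1 w2 :
  epath u t w1 -> epath t v w2 -> epath u v (w1 ++ w2).
Proof.
elim: w1 u => [|e w1 IH] u /= => [/eqP-> //|/andP[-> /IH]]; exact.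
Qed.

Lemma epath_cons u v e w : epath u v (e :: w) =
  [&& src e == u, path (fun e f => tgt e == src f) e w & tgt (last e w) == v].
Proof.
elim: w u e => [|e' w IH] u e //=.
by rewrite -andbA; congr (_ && _); have /= -> := IH (tgt e) e'; rewrite eq_sym.
Qed.

Lemma walk_epath w : walk w -> exists u v, epath u v w.
Proof.
case: w => // e w /andP[_ we]; exists (src e), (tgt (last e w)).
by rewrite epath_cons !eqxx andbT.
Qed.

Lemma epath_walk u v w : 0 < size w -> epath u v w -> walk w.
Proof. by case: w => // e w _; rewrite epath_cons => /and3P[_ we _]. Qed.

Lemma walk_betweenE u v w : walk_between u v w = (w != [::]) && epath u v w.
Proof.
case: w => // e w; rewrite epath_cons /walk_between /walk /=.
by rewrite andbCA.
Qed.

Definition conn n u v : Prop := exists2 w, size w = n & epath u v w.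

Lemma connD m n u t v : conn m u t -> conn n t v -> conn (m + n) u v.
Proof.
move=> [w1 <- p1] [w2 <- p2]; exists (w1 ++ w2); first by rewrite size_cat.
exact: epath_cat p1 p2.
Qed.

Hypothesis prim : primitive_graph G.

(** Without vertices there are no cycles, and 2 would vacuously divide all their lengths. *)
Lemma primitive_vertex : exists v : vertex G, True.
Proof.
apply: contrapT => noV; case: prim => _ [_ gcd1].
suff /gcd1 : forall n, cycle_length G n -> 2 %| n by [].
by move=> n [w [[v _] _]]; case: noV; exists v.
Qed.

Lemma primitive_out v : exists e : edge G, src e == v.
Proof.
by have [[|e w]] := prim.1 v v; rewrite walk_betweenE //= => /andP[? _]; exists e.
Qed.

Lemma primitive_in v : exists e : edge G, tgt e == v.
Proof.
have [[|e w]] := prim.1 v v; rewrite walk_betweenE // epath_cons.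
by case/and4P=> _ _ _ ?; exists (last e w).
Qed.

Lemma irreducible_conn u v : exists n, conn n u v.
Proof.
by have [w] := prim.1 u v; rewrite walk_betweenE => /andP[_ p]; exists (size w), w.
Qed.

(** All large lengths occur for closed walks at one vertex [v0]; walks into and out of [v0] are then
    padded there to a common total. *)
Lemma primitive_index : exists N, forall u v, conn N u v.
Proof.
have [v0 _] := primitive_vertex.
have [K hK] : exists K, forall n, K <= n -> conn n v0 v0.
  apply: cofinite_of_additive => [|m n|d dvd_d]; first by exists [::] => /=.
    exact: connD.
  (* A divisor of all return lengths at [v0] divides a detour through [v] both with and without the
     cycle [w], hence [size w]. *)
  case: prim => _ [_]; apply=> ? [w [[v wv] <-]]; move: wv.
  rewrite walk_betweenE => /andP[_ p].
  have cw : conn (size w) v v by exists w.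
  have [m c1] := irreducible_conn v0 v; have [n c2] := irreducible_conn v v0.
  have := dvd_d _ (connD (connD c1 cw) c2); have := dvd_d _ (connD c1 c2).
  by rewrite addnAC => /dvdn_addr ->.
have [a ha] := choice (fun u => irreducible_conn u v0).
have [b hb] := choice (fun v => irreducible_conn v0 v).
exists (K + (\max_u a u + \max_v b v)) => u v.
have le_a : a u <= \max_u a u by exact: leq_bigmax.
have le_b : b v <= \max_v b v by exact: leq_bigmax.
pose m := K + (\max_u a u - a u) + (\max_v b v - b v).
have cm : conn m v0 v0 by apply: hK; rewrite /m -addnA leq_addr.
have -> : K + (\max_u a u + \max_v b v) = a u + m + b v by rewrite /m; lia.
exact: connD (connD (ha u) cm) (hb v).
Qed.

End Paths.

(** * Min-plus dynamic programming for the distance to the code *)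

Section MinPlus.
Variables (A : finType) (G : labeled_graph A).
Notation V := (vertex (lgraph G)).
Notation E := (edge (lgraph G)).
Implicit Types (y : V -> nat) (u v t : V) (e : E) (w : seq A) (p : seq E).

Definition mismatches w p : nat := count (fun x => x.1 != label x.2) (zip w p).

Lemma mismatches_le w p : size p = size w -> mismatches w p <= size w.
Proof. by move=> sp; rewrite -(size1_zip (eq_leq (esym sp))) count_size. Qed.

Variables (out inn : V -> E) (v0 : V).
Hypotheses (outP : forall v, src (out v) == v) (innP : forall v, tgt (inn v) == v).

Definition edge_cost a y e := (a != label e) + y (tgt e).

Definition bellman a y v :=
  edge_cost a y [arg min_(e < out v | src e == v) edge_cost a y e].

Lemma bellman_le a y e : bellman a y (src e) <= edge_cost a y e.
Proof. by rewrite /bellman; case: arg_minnP => // e' _; apply. Qed.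

Lemma bellman_ex a y v :
  exists2 e, src e == v & bellman a y v = edge_cost a y e.
Proof. by rewrite /bellman; case: arg_minnP => // e ev _; exists e. Qed.

(** By [value_le] and [value_ex], this is the least cost of reading [w] along a walk from a given
    vertex, with terminal cost [y]. A general [y] lets a word be split into prefix and suffix. *)
Definition value w y : V -> nat := foldr bellman y w.

Lemma value_le w y u v p :
  epath u v p -> size p = size w -> value w y u <= mismatches w p + y v.
Proof.
elim: w u p => [|a w IH] u [|e p] //=; first by move=> /eqP->.
move=> /andP[/eqP<- pv] [sp]; apply: leq_trans (bellman_le _ _ _) _.
by rewrite /edge_cost /mismatches /= -addnA leq_add2l; exact: IH.
Qed.

Lemma value_ex w y u : exists v p,
  [/\ epath u v p, size p = size w & value w y u = mismatches w p + y v].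
Proof.
elim: w u => [|a w IH] u /=; first by exists u, [::]; rewrite /= eqxx.
have [e eu ->] := bellman_ex a (value w y) u; have [v [p [pv sp E]]] := IH (tgt e).
exists v, (e :: p); rewrite /= eu pv sp /edge_cost.
by rewrite -/(value w y) E addnA.
Qed.

Definition minv y := y [arg min_(v < v0) y v].

Lemma minv_le y v : minv y <= y v.
Proof. by rewrite /minv; case: arg_minnP => // t _; apply. Qed.

Lemma minv_ex y : exists v, minv y = y v.
Proof. by eexists. Qed.

Lemma minv_value_le w y u : minv y <= value w y u.
Proof.
have [v [p [_ _ ->]]] := value_ex w y u.
by apply: leq_trans (minv_le y v) _; exact: leq_addl.
Qed.

Lemma in_path n v : exists u, exists2 p, size p = n & epath u v p.
Proof.
elim: n => [|n [u [p sp pv]]]; first by exists v, [::] => /=.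
exists (src (inn u)), (inn u :: p); first by rewrite /= sp.
by rewrite /= eqxx (eqP (innP u)).
Qed.

(** Min-plus maps are monotone and commute with constants; the pair [c], [c'] encodes a constant of
    either sign. *)
Lemma value_shift w y y' c c' : (forall v, y v + c' <= y' v + c) ->
  forall v, value w y v + c' <= value w y' v + c.
Proof.
move=> le_y u; have [v [p [pv sp ->]]] := value_ex w y' u.
by have := value_le y pv sp; have := le_y v; lia.
Qed.

Lemma minv_shift y y' c c' : (forall v, y v + c' <= y' v + c) ->
  minv y + c' <= minv y' + c.
Proof. by move=> le_y; have [v ->] := minv_ex y'; have := minv_le y v; have := le_y v; lia. Qed.

Definition distance w := minv (value w (fun=> 0)).

Lemma distance_nil : distance [::] = 0.
Proof. by []. Qed.

Lemma distance_mono (w u : seq A) : distance u <= distance (w ++ u).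
Proof.
rewrite /distance /value foldr_cat -!/(value _ _).
by have [v ->] := minv_ex (value w (value u (fun=> 0))); exact: minv_value_le.
Qed.

(** An optimal walk for [u] extends backwards by [size w] edges, each adding at most one
    mismatch. *)
Lemma distance_lip (w u : seq A) : distance (w ++ u) <= size w + distance u.
Proof.
rewrite /distance /value foldr_cat -!/(value _ _).
have [v ->] := minv_ex (value u (fun=> 0)); have [t [p sp pv]] := in_path (size w) v.
apply: leq_trans (minv_le _ t) _; apply: leq_trans (value_le _ pv sp) _.
by rewrite leq_add2r mismatches_le.
Qed.

Variable N : nat.
Hypothesis connN : forall u v, conn N u v.

(* Reading the first [N] letters of [w] along a walk from [v] to a minimum of
   the value of the remaining suffix costs at most [N]. *)
Lemma value_osc w v : value w (fun=> 0) v <= distance w + N.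
Proof.
have [le_wN|lt_Nw] := leqP (size w) N.
  have [t [p [_ sp ->]]] := value_ex w (fun=> 0) v.
  by have := mismatches_le sp; lia.
rewrite -(cat_take_drop N w); set w1 := take N w; set w2 := drop N w.
have sw1 : size w1 = N by rewrite size_takel // ltnW.
have := distance_mono w1 w2; rewrite {1}/distance.
rewrite /value foldr_cat -!/(value _ _); have [t ->] := minv_ex (value w2 (fun=> 0)).
have [p sp pt] := connN v t; rewrite -sw1 in sp.
by have := value_le (value w2 (fun=> 0)) pt sp; have := mismatches_le sp; lia.
Qed.

(** By [value_osc] the differences are at most [N], so [inord] truncates nothing and equal profiles
    mean value functions equal up to a constant. *)
Definition profile w : {ffun V -> 'I_N.+1} :=
  [ffun v => inord (value w (fun=> 0) v - distance w)].

Lemma profile_value (u u' : seq A) : profile u = profile u' -> forall v,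
  value u (fun=> 0) v + distance u' = value u' (fun=> 0) v + distance u.
Proof.
move=> /ffunP eq_uu' v; have := congr1 val (eq_uu' v); rewrite !ffunE /= !inordK.
- have := minv_le (value u (fun=> 0)) v; have := minv_le (value u' (fun=> 0)) v.
  rewrite -!/(distance _); lia.
- by have := value_osc u' v; lia.
- by have := value_osc u v; lia.
Qed.

Lemma distance_class (u u' w : seq A) : profile u = profile u' ->
  distance (w ++ u) + distance u' = distance (w ++ u') + distance u.
Proof.
move=> /profile_value E; rewrite /distance /value !foldr_cat -!/(value _ _).
apply/eqP; rewrite eqn_leq.
by apply/andP; split; apply: minv_shift; apply: value_shift => v;
  have := E v; rewrite /distance; lia.
Qed.

End MinPlus.

(** * From words of the shift to walks *)

Section Code.
Variables (A : finType) (G : labeled_graph A).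
Notation V := (vertex (lgraph G)).
Notation E := (edge (lgraph G)).

Lemma graph_codeP n (c : n.-tuple A) :
  reflect (exists2 p : seq E, walk p & map (@label A G) p = c)
          (c \in graph_code G n).
Proof.
apply: (iffP imsetP) => [[p wp ->]|[p wp Ec]].
  by exists p => //; rewrite inE in wp.
have sp : size p == n by rewrite -(size_map (@label A G)) Ec size_tuple.
by exists (Tuple sp); rewrite ?inE //; apply/val_inj.
Qed.

Lemma hammingE n (v c : n.-tuple A) (p : seq E) : map (@label A G) p = c ->
  hamming v c = mismatches v p.
Proof.
move=> Ec; rewrite /hamming /mismatches cardsE.
have -> : count (fun x => x.1 != label x.2) (zip v p) =
    count (fun x => x.1 != x.2) (zip v c).
  have szE : size p = size v by rewrite -(size_map (@label A G)) Ec !size_tuple.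
  rewrite -Ec; elim: (tval v) p szE {Ec} => [|a w IH] [|e p] //= [sp].
  by rewrite IH.
rewrite -[v in zip v]map_tnth_enum -[c in zip _ c]map_tnth_enum zip_map count_map.
rewrite cardE {1}/enum_mem -enumT size_filter; exact: eq_count.
Qed.

Variables (out inn : V -> E).
Hypotheses (outP : forall v, src (out v) == v) (innP : forall v, tgt (inn v) == v).

Lemma biinfinite_walk (p : seq E) : walk p -> exists z : int -> E,
  (forall i, tgt (z i) == src (z (i + 1)%R)) /\
  p = [seq z (Posz i) | i <- iota 0 (size p)].
Proof.
case: p => // e0 p0 /andP[_ wp]; pose p := e0 :: p0.
pose fwd := fix fwd (k : nat) : E := if k is k'.+1 then
  (if k < size p then nth e0 p k else out (tgt (fwd k'))) else e0.
pose bwd := fix bwd (k : nat) : E := if k is k'.+1 then inn (src (bwd k')) else e0.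
have fwdE k : k < size p -> fwd k = nth e0 p k by case: k => //= k ->.
exists (fun i => match i with Posz k => fwd k | Negz k => bwd k.+1 end); split.
  case=> [k|[|k]].
  - rewrite -PoszD addn1; case: (ltnP k.+1 (size p)) => lt_k.
      by rewrite !fwdE ?(ltnW lt_k) //; have /(pathP e0) := wp; exact.
    by rewrite [fwd k.+1]/= ltnNge lt_k /= eq_sym.
  - exact: innP.
  - have -> : (Negz k.+1 + 1)%R = Negz k by lia.
    exact: innP.
apply: (@eq_from_nth _ e0) => [|i lt_i]; first by rewrite size_map size_iota.
by rewrite (nth_map 0) ?size_iota // nth_iota // add0n fwdE.
Qed.

(** Every finite walk extends to a bi-infinite one. Length 0 is excluded because [walk] rejects the
    empty sequence. *)
Lemma sofic_code n : 0 < n -> shift_code (sofic_shift G) n = graph_code G n.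
Proof.
move=> n0; apply/setP => c; rewrite inE; apply/asboolP/idP.
  move=> [x [Xx <-]].
  have /(_ 1%R (Posz n)) := Xx; have -> : `|(Posz n - 1 + 1)%R|%N = n by lia.
  by apply; lia.
move=> /graph_codeP[p wp Ec]; have [z [adj Ep]] := biinfinite_walk wp.
have sp : size p = n by rewrite -(size_map (@label A G)) Ec size_tuple.
(* The walk [p] sits at indices from 0, while [shift_code] reads from coordinate 1. *)
exists (fun i => label (z (i - 1)%R)); split.
  move=> m k le_mk; set l := `|_|%N.
  pose q := [seq z (m + Posz i - 1)%R | i <- iota 0 l].
  apply/graph_codeP; exists q.
    rewrite /walk -size_eq0 size_map size_iota; apply/andP; split; first by rewrite /l; lia.
    rewrite sorted_map; apply: (@sub_sorted _ (fun i j => j == i.+1)).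
      move=> i j /= /eqP->; have -> // : (m + Posz i.+1 - 1 = (m + Posz i - 1) + 1)%R by lia.
    case: l {q} => // l /=; elim: l 0 => //= l IH i; by rewrite eqxx IH.
  rewrite -map_comp /window /= -[in LHS]val_enum_ord -map_comp.
  by [].
apply/val_inj; rewrite /= -Ec Ep sp -val_enum_ord -!map_comp; apply: eq_map => i /=.
by congr (label (z _)); lia.
Qed.

Lemma bigmin_le (I : finType) (P : pred I) (F : I -> nat) n i :
  P i -> \big[minn/n]_(j | P j) F j <= F i.
Proof.
have := mem_index_enum i.
elim: (index_enum I) => // j s IH; rewrite inE big_cons => /orP[/eqP<- ->|/IH{}IH Pi].
  exact: geq_minl.
by case: ifP => _; rewrite ?geq_min IH ?orbT.
Qed.

Variable v0 : V.
Notation dist := (distance out v0).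

Lemma bigmin_hamming n (v : n.-tuple A) : 0 < n ->
  \big[minn/n]_(c in graph_code G n) hamming v c = dist v.
Proof.
move=> n0; apply/eqP; rewrite eqn_leq; apply/andP; split.
  have [u Eu] := minv_ex v0 (value out v (fun=> 0)).
  have [t [p [pt sp E]]] := value_ex outP v (fun=> 0) u.
  rewrite /distance Eu E addn0; rewrite size_tuple in sp.
  have sc : size (map (@label A G) p) == n by rewrite size_map sp.
  rewrite -(@hammingE _ v (Tuple sc) p) //; apply: bigmin_le.
  by apply/graph_codeP; exists p => //; apply: epath_walk pt; rewrite sp.
apply: (big_ind (fun k => dist v <= k)) => [|i j|c /graph_codeP[p wp Ec]].
(* The base value [n] of the minimum is also at least the distance. *)
- have := distance_lip v0 outP innP v [::].
  by rewrite cats0 distance_nil addn0 size_tuple.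
- by rewrite leq_min => -> ->.
rewrite (hammingE _ Ec); have [u [t pt]] := walk_epath wp.
have sp : size p = size v by rewrite -(size_map (@label A G)) Ec !size_tuple.
apply: leq_trans (minv_le _ _ u) _.
by have := value_le outP (fun=> 0) pt sp; rewrite addn0.
Qed.

End Code.

(** * Linear growth of the covering radius and its limit *)

Lemma covering_growth (A : finType) (G : labeled_graph A) :
  primitive_labeled_graph G -> exists q p C, 0 < q /\ forall n, 0 < n ->
    let M := code_covering_radius (shift_code (sofic_shift G) n) in
    q * M <= p * n + C /\ p * n <= q * M + C.
Proof.
move=> hG; have [v0 _] := primitive_vertex hG.
have [out outP] := choice (primitive_out hG).
have [inn innP] := choice (primitive_in hG).
have [N connN] := primitive_index hG.
have [q [p [C [q0 growth]]]] := linear_growth (label (out v0))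
  (distance_nil out v0) (distance_mono v0 outP) (distance_lip v0 outP innP)
  (distance_class outP connN).
exists q, p, C; split=> // n n0 M.
have EM : M = \max_(v : n.-tuple A) distance out v0 v.
  rewrite /M (sofic_code outP innP n0); apply: eq_bigr => v _.
  exact: bigmin_hamming.
have [upper [w sw lower]] := growth n; rewrite EM; split.
  have words : 0 < #|{: n.-tuple A}|.
    by apply/card_gt0P; exists (nseq_tuple n (label (out v0))).
  have [v ->] := eq_bigmax (fun v : n.-tuple A => distance out v0 v) words.
  by apply: upper; rewrite size_tuple.
apply: leq_trans lower _; rewrite leq_add2r leq_mul2l.
have sw' : size w == n by apply/eqP.
by rewrite (leq_bigmax (Tuple sw')) orbT.
Qed.

Import Order.TTheory GRing.Theory Num.Theory.

Lemma cvg_linear_growth (R : realType) (M : nat -> nat) (q p C : nat) : 0 < q ->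
  (forall n, 0 < n -> q * M n <= p * n + C /\ p * n <= q * M n + C) ->
  ((fun n => (M n)%:R / n%:R : R) @ \oo --> (p%:R / q%:R : R))%classic%R.
Proof.
move=> q0 bnd; apply/cvgrPdist_le => e e0; near=> n.
have n0 : 0 < n by near: n; exists 1.
have qR : (0 < q%:R :> R)%R by rewrite ltr0n.
have nR : (0 < n%:R :> R)%R by rewrite ltr0n.
have [up low] := bnd n n0.
have -> : (p%:R / q%:R - (M n)%:R / n%:R = ((p * n)%:R - (q * M n)%:R) / (q * n)%:R :> R)%R.
  by rewrite !natrM; field; rewrite !gt_eqF.
rewrite normrM normfV (ger0_norm (ler0n _ _)) ler_pdivrMr ?ltr0n ?muln_gt0 ?q0 //.
have le_C : (`|(p * n)%:R - (q * M n)%:R| <= C%:R :> R)%R.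
  rewrite ler_distlC -!natrD; apply/andP; split.
    by rewrite lerBlDr -natrD ler_nat.
  by rewrite ler_nat.
apply: le_trans le_C _; rewrite natrM.
(* The error is at most [C / (q * n)], so [n >= C / e] suffices as [q >= 1]. *)
have le_n : (C%:R / e <= n%:R :> R)%R by near: n; exact: nbhs_infty_ger.
rewrite ler_pdivrMr // in le_n; apply: le_trans le_n _.
rewrite [leRHS]mulrCA mulrC ler_peMl ?mulr_ge0 ?ler0n ?(ltW e0) //.
by rewrite ler1n.
Unshelve. all: by end_near.
Qed.

Theorem theoremA (R : realType) (A : finType) (G : labeled_graph A)
    (hG : primitive_labeled_graph G) :
  cvgn (covering_rate R (sofic_shift G)) /\
  rational (covering_radius R (sofic_shift G)).
Proof.
have [q [p [C [q0 growth]]]] := covering_growth hG.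
have lim_rate := @cvg_linear_growth R _ _ _ _ q0 growth.
split; first by apply/cvg_ex; exists (p%:R / q%:R)%R.
exists (p%:R / q%:R)%R => //.
by rewrite fmorph_div /= !ratr_nat; apply/esym/cvg_lim.
Qed.
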